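(* Let $p$ be a prime and $\mathbb{F}=\mathbb{F}_p$. There is a constant $\epsilon>0$, depending on $p$ but not on $N$, such that for every $N\ge 1$ the elementary symmetric polynomial $S_{2p}(x)=\sum_{T\subseteq[N],\,|T|=2p}\prod_{i\in T}x_i$, viewed as a function $\mathbb{F}^N\to\mathbb{F}$, satisfies $$\|S_{2p}\|_{U^{p+2}}>\epsilon .$$
   Context: For $f:\mathbb{F}_p^N\to\mathbb{F}_p$ and $y\in\mathbb{F}_p^N$, the directional derivative is $f_y(x)=f(x+y)-f(x)$, and iterated derivatives are $f_{y_1\dots y_k}=(f_{y_1\dots y_{k-1}})_{y_k}$. Let $e(a)=e^{2\pi i a/p}$ for $a\in\mathbb{F}_p$. The $k$-th Gowers norm is $\|f\|_{U^k}=\left(\mathbb{E}_{x,y_1,\dots,y_k\in\mathbb{F}_p^N}\, e\big(f_{y_1\dots y_k}(x)\big)\right)^{1/2^k}$ (the expectation is a nonnegative real). *)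

(* Defs.v *)
From HB Require Import structures.
From mathcomp Require Import all_boot all_order all_algebra.
From mathcomp Require Import complex.
From mathcomp Require Import reals exp trigo.
Set Implicit Arguments. Unset Strict Implicit. Unset Printing Implicit Defensive.
Import Order.TTheory GRing.Theory Num.Theory.
Local Open Scope ring_scope.
Local Open Scope complex_scope.

Notation Fvec p N := 'rV['F_p]_N.

Definition dderiv (p N : nat) (f : Fvec p N -> 'F_p) (y : Fvec p N)
  : Fvec p N -> 'F_p := fun x => f (x + y) - f x.

Fixpoint iderivs (p N : nat) (f : Fvec p N -> 'F_p) (ys : seq (Fvec p N))
  : Fvec p N -> 'F_p :=
  match ys with
  | [::] => f
  | y :: ys' => iderivs (dderiv f y) ys'
  end.

Definition ep (R : realType) (p : nat) (a : 'F_p) : R[i] :=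
  let t : R := 2 * pi * (nat_of_ord a)%:R / p%:R in
  (cos t) +i* (sin t).

Definition gowers_avg (R : realType) (p N k : nat) (f : Fvec p N -> 'F_p) : R[i] :=
  (\sum_(x : Fvec p N) \sum_(ys : k.-tuple (Fvec p N)) ep R (iderivs f ys x))
    / ((#|{: Fvec p N}| ^ k.+1)%:R).

(* ||f||_{U^k} = (E ...)^(1/2^k); the expectation is a nonnegative real
   number, so we take its real part and its real 2^k-th root (powR). *)
Definition gowers_norm (R : realType) (p N k : nat) (f : Fvec p N -> 'F_p) : R :=
  powR (complex.Re (gowers_avg R k f)) ((2 ^ k)%:R)^-1.

Definition esym_fun (p N m : nat) (x : Fvec p N) : 'F_p :=
  \sum_(T : {set 'I_N} | #|T| == m) \prod_(i in T) x ord0 i.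

(* Main.v *)
Require Import Defs.
From HB Require Import structures.
From mathcomp Require Import all_boot all_order all_algebra.
From mathcomp Require Import complex.
From mathcomp Require Import reals exp trigo.
From mathcomp Require Import qpoly finfield ring.
Set Implicit Arguments. Unset Strict Implicit. Unset Printing Implicit Defensive.
Import Order.TTheory GRing.Theory Num.Theory.
Local Open Scope ring_scope.

(** S_{2p}(x) is the coefficient of t^{2p} in g(x) = prod_i (1 + x_i t), seen in
    the unit group U of F_p[t]/(t^{2p+1}).  The map phi : a |-> 1 + a t from F_p
    to U has vanishing (p+2)-fold differences: in Z[F_p], with T the generator,
    (T-1)^{p-1} is the norm element plus a multiple of p, and the norm element is
    killed by T-1, so it suffices that the third differences of
    phi^p : a |-> 1 + a t^p vanish, which holds because (t^p)^3 = 0.  Hence so do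
    the (p+2)-fold differences of g, and a cube of dimension p+2 having all
    vertices but one in a level set A of g lies entirely in A.  As S_{2p} is
    constant on A, Cauchy-Schwarz in each direction of the cube bounds the U^{p+2}
    norm of S_{2p} below by that of the indicator of A, which is at least the
    density of A; and some level set has density at least 1/p^{2p+1}. *)

Lemma big_tuple_cons (V : finType) (C : nmodType) m (f : seq V -> C) :
  \sum_(ys : m.+1.-tuple V) f ys = \sum_y \sum_(ys : m.-tuple V) f (y :: ys).
Proof.
rewrite pair_bigA /=.
rewrite (reindex (fun z : V * m.-tuple V => [tuple of z.1 :: z.2])) //=.
exists (fun ys : m.+1.-tuple V => (thead ys, [tuple of behead ys])) => [[y ys] _|ys _] /=.
  by congr pair; apply: val_inj.
by rewrite [RHS]tuple_eta; apply: val_inj.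
Qed.

(** * Iterated differences of maps between abelian groups *)

Section FiniteDifferences.

(** The head direction is differenced last, so a difference over a cube splits into those over two
    opposite faces, matching the recursion of [cube]. *)
Fixpoint fdiffs (V U : zmodType) (h : V -> U) (ys : seq V) (x : V) : U :=
  if ys is y :: ys' then fdiffs h ys' (x + y) - fdiffs h ys' x else h x.

Variables V U : zmodType.
Implicit Types (h : V -> U) (ys zs : seq V).

Lemma eq_fdiffs h h' ys : h =1 h' -> fdiffs h ys =1 fdiffs h' ys.
Proof. by move=> hh'; elim: ys => //= y ys IH x; rewrite !IH. Qed.

Lemma fdiffs_cat h ys zs x : fdiffs h (ys ++ zs) x = fdiffs (fdiffs h zs) ys x.
Proof. by elim: ys x => //= y ys IH x; rewrite !IH. Qed.

Lemma fdiffs_shift h ys c x :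
  fdiffs (fun z => h (z + c)) ys x = fdiffs h ys (x + c).
Proof. by elim: ys x => //= y ys IH x; rewrite !IH addrAC. Qed.

Lemma fdiffsD h h' ys x :
  fdiffs (fun z => h z + h' z) ys x = fdiffs h ys x + fdiffs h' ys x.
Proof. by elim: ys x => //= y ys IH x; rewrite !IH opprD addrACA. Qed.

Lemma fdiffs_cst (c : U) y ys x : fdiffs (fun=> c) (y :: ys) x = 0.
Proof. by elim: ys y x => /= [|z ys IH] y x; rewrite ?subrr // !IH subrr. Qed.

Lemma fdiffs_const_shift h (c : U) y ys x :
  fdiffs (fun z => h z - c) (y :: ys) x = fdiffs h (y :: ys) x.
Proof. by rewrite fdiffsD fdiffs_cst addr0. Qed.

Lemma fdiffs_zero ys x : fdiffs (fun=> 0 : U) ys x = 0.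
Proof. by elim: ys x => //= y ys IH x; rewrite !IH subrr. Qed.

Lemma fdiffs_sum (I : Type) (r : seq I) (H : I -> V -> U) ys x :
  fdiffs (fun z => \sum_(i <- r) H i z) ys x = \sum_(i <- r) fdiffs (H i) ys x.
Proof.
elim: r => [|i r IH].
  rewrite big_nil -[RHS](fdiffs_zero ys x).
  by apply: eq_fdiffs => z; rewrite big_nil.
rewrite big_cons -IH -fdiffsD.
by apply: eq_fdiffs => z; rewrite big_cons.
Qed.

Lemma fdiffs_mulrz h (c : int) ys x :
  fdiffs (fun z => h z *~ c) ys x = fdiffs h ys x *~ c.
Proof. by elim: ys x => //= y ys IH x; rewrite !IH mulrzBl. Qed.

Lemma fdiffs_comp (V' : zmodType) (f : {additive V' -> V}) h (ys : seq V') x :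
  fdiffs (fun z => h (f z)) ys x = fdiffs h (map f ys) (f x).
Proof. by elim: ys x => //= y ys IH x; rewrite !IH raddfD. Qed.

(** Difference operators commute; this links [fdiffs] to the order used by [iderivs]. *)
Lemma fdiffs_first h y ys x :
  fdiffs (fun z => h (z + y) - h z) ys x = fdiffs h (y :: ys) x.
Proof.
elim: ys x => //= z ys IH x; rewrite !IH /= (addrAC x z y) !opprB !addrA.
by rewrite [LHS]addrAC [RHS]addrAC; congr (_ + _); exact: addrAC.
Qed.

Lemma fdiffs_nseq_binomial h (y : V) n x :
  fdiffs h (nseq n y) x =
  \sum_(j < n.+1) h (x + y *+ (n - j)) *~ ((-1) ^+ j * 'C(n, j)%:Z).
Proof.
elim: n x => [|n IH] x.
  by rewrite /= big_ord_recl big_ord0 !addr0 /= expr0 mulr1z.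
rewrite /= !IH; symmetry.
(* Pascal's rule: [d] is the coefficient sequence shifted by one, set to 0 at index 0. *)
pose d j : int := if j is i.+1 then (-1) ^+ i * 'C(n, i)%:Z else 0.
rewrite (eq_bigr (fun j : 'I_n.+2 =>
    h (x + y *+ (n.+1 - j)) *~ ((-1) ^+ j * 'C(n, j)%:Z)
    - h (x + y *+ (n.+1 - j)) *~ d j)).
  rewrite sumrB; congr (_ - _).
    rewrite big_ord_recr /= bin_small // mulr0 mulr0z addr0.
    by apply: eq_bigr => j _; rewrite subSn -1?ltnS // mulrS addrA.
  by rewrite big_ord_recl /= mulr0z add0r; apply: eq_bigr => j _.
move=> [[|j] ltj] _; rewrite -mulrzBr; congr (_ *~ _).
  by rewrite /= !bin0 subr0.
by rewrite /= binS PoszD exprS; ring.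
Qed.

End FiniteDifferences.

Lemma iderivsE p N (f : Fvec p N -> 'F_p) ys x : iderivs f ys x = fdiffs f ys x.
Proof.
elim: ys f x => //= y ys IH f x.
by rewrite IH; exact: fdiffs_first.
Qed.

(** * Differences of functions on [F_p] *)

Section PrimeField.

Variables (p : nat) (p_pr : prime p).

(** Consecutive signed terms differ by a multiple of ['C(p, j.+1)], which [p] divides. *)
Lemma dvdz_signed_bin_pred j : (j < p)%N ->
  (p%:Z %| (-1) ^+ j * 'C(p.-1, j)%:Z - 1)%Z.
Proof.
elim: j => [|j IH] ltjp; first by rewrite bin0 mul1r subrr dvdz0.
have -> : (-1) ^+ j.+1 * 'C(p.-1, j.+1)%:Z - 1 =
    (-1) ^+ j.+1 * 'C(p, j.+1)%:Z + ((-1) ^+ j * 'C(p.-1, j)%:Z - 1) :> int.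
  by rewrite -[in 'C(p, _)](prednK (prime_gt0 p_pr)) binS PoszD exprS; ring.
rewrite rpredD ?IH ?(ltnW ltjp) // dvdz_mull // dvdzE /=.
by rewrite prime_dvd_bin.
Qed.

Variables (U : zmodType) (h : 'F_p -> U).

Lemma step1_invariant (H : 'F_p -> U) :
  (forall x, H (x + 1) = H x) -> forall x y, H (x + y) = H x.
Proof.
move=> H1 x y; rewrite -[y]natr_Zp.
by elim: (nat_of_ord y) => [|n IH]; rewrite ?addr0 // mulrSr addrA H1.
Qed.

(** As 1 generates [F_p], a function unchanged by the shift by 1 is constant. Since differences
    commute, each direction can be traded for 1 in turn. *)
Lemma fdiffs_all_steps m :
  (forall x, fdiffs h (nseq m 1) x = 0) ->
  forall ys, size ys = m -> forall x, fdiffs h ys x = 0.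
Proof.
move=> h0 ys; elim: ys m h h0 => [|y ys IH] m k k0 sz x; first by move: sz k0 => <-.
rewrite /= (@step1_invariant (fdiffs k ys)) ?subrr // => {}x.
apply/eqP; rewrite -subr_eq0; apply/eqP.
move: sz k0 => <- k0.
rewrite -[LHS](fdiffs_first k 1 ys x); apply: (IH _ _ _ erefl) => z.
by rewrite fdiffs_first; exact: k0.
Qed.

(* In Z[Z/p], (T - 1)^(p-1) is congruent to 1 + T + ... + T^(p-1) modulo p, and
   the latter is killed by T - 1. *)
Lemma fdiffs_prime_torsion m :
  (forall x, fdiffs (fun z => h z *+ p) (nseq m.+1 1) x = 0) ->
  forall x, fdiffs h (nseq (m.+1 + p.-1) 1) x = 0.
Proof.
move=> hp0 x.
have /fin_all_exists [c cE] (j : 'I_p) : exists c : int,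
    (-1) ^+ j * 'C(p.-1, j)%:Z = 1 + p%:Z * c.
  have /dvdzP[c ec] := dvdz_signed_bin_pred (ltn_ord j).
  by exists c; rewrite (mulrC p%:Z) -ec addrCA subrr addr0.
rewrite nseqD fdiffs_cat.
pose S z := \sum_(j < p) h (z + 1 *+ (p.-1 - j)).
rewrite (@eq_fdiffs _ _ _ (fun z => S z + \sum_(j < p)
  (h (z + 1 *+ (p.-1 - j)) *+ p) *~ c j)); last first.
  move=> z; rewrite fdiffs_nseq_binomial prednK ?prime_gt0 // -big_split /=.
  by apply: eq_bigr => j _; rewrite cE mulrzDr mulr1z mulrzA.
rewrite fdiffsD [X in _ + X](_ : _ = 0) ?addr0; last first.
  apply: etrans (fdiffs_sum _ _ _ _) _; apply: big1 => j _.
  apply: etrans (fdiffs_mulrz _ _ _ _) _.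
  rewrite [X in X *~ _](_ : _ = 0) ?mul0rz //.
  exact: etrans (fdiffs_shift (fun z => h z *+ p) _ _ _) (hp0 _).
have S1 z : S (z + 1) = S z.
  apply/eqP; rewrite -subr_eq0 /S.
  (* Reversing the index makes the difference telescope to [h (z + 1 *+ p) - h z], which is 0 in
     characteristic [p]. *)
  rewrite (reindex_inj rev_ord_inj) [X in _ - X](reindex_inj rev_ord_inj) /= -sumrB.
  rewrite (eq_bigr (fun j : 'I_p => h (z + 1 *+ j.+1) - h (z + 1 *+ j))).
    rewrite -(big_mkord xpredT (fun j => h (z + 1 *+ j.+1) - h (z + 1 *+ j))).
    by rewrite telescope_sumr // pchar_Fp_0 // mulr0n subrr.
  move=> j _.
  have -> : (p.-1 - (p - j.+1) = j)%N.
    by rewrite -subn1 -subnDA add1n subnSK // subKn // ltnW.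
  by rewrite mulrS addrA.
rewrite (@eq_fdiffs _ _ _ (fun=> S 0)) => [|z]; first exact: fdiffs_cst.
by rewrite -(step1_invariant S1 0 z) add0r.
Qed.

End PrimeField.

Lemma eq_ler (R : numDomainType) (x y : R) : x = y -> x <= y.
Proof. by move->. Qed.

(** * Cube sums and Cauchy-Schwarz *)

Section Cubes.

Variables (V : finZmodType) (C : numClosedFieldType).
Implicit Types (F G A : V -> C) (ys : seq V).

(* The product over the vertices of the cube based at x with sides ys, with
   alternating conjugations, of F at the vertex x and G at all others. *)
Fixpoint cube F G ys (x : V) : C :=
  if ys is y :: ys' then cube G G ys' (x + y) * (cube F G ys' x)^* else F x.

Definition cube_sum F G m : C := \sum_(ys : m.-tuple V) \sum_x cube F G ys x.

Definition mdiff F y : V -> C := fun x => F (x + y) * (F x)^*.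

Lemma cube_mdiff F G y ys x :
  cube (mdiff F y) (mdiff G y) ys x = cube F G ys (x + y) * (cube F G ys x)^*.
Proof.
elim: ys F x => //= w ys IH F x.
by rewrite !IH !rmorphM /= !conjCK (addrAC x w y); ring.
Qed.

Lemma sum_shift (f : V -> C) x : \sum_y f (x + y) = \sum_y f y.
Proof. by rewrite [RHS](reindex_inj (addrI x)). Qed.

(** For fixed [x], the point [x + y] runs over all of [V], so the two opposite faces decouple. *)
Lemma sum_cube_cons F G ys :
  \sum_y \sum_x cube F G (y :: ys) x =
  (\sum_x cube G G ys x) * (\sum_x cube F G ys x)^*.
Proof.
rewrite exchange_big rmorph_sum mulr_sumr; apply: eq_bigr => x _ /=.
by rewrite -mulr_suml (sum_shift (cube G G ys)).
Qed.

(** Here both opposite faces carry an [F] vertex, whence a square, unlike in [sum_cube_cons]. *)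
Lemma sum_cube_mdiff F G ys :
  \sum_y \sum_x cube (mdiff F y) (mdiff G y) ys x = `|\sum_x cube F G ys x| ^+ 2.
Proof.
rewrite normCK rmorph_sum mulr_sumr exchange_big; apply: eq_bigr => x _ /=.
by under eq_bigr do rewrite cube_mdiff; rewrite -mulr_suml (sum_shift (cube F G ys)).
Qed.

Lemma cube_sumS F G m :
  cube_sum F G m.+1 = \sum_(ys : m.-tuple V)
    (\sum_x cube G G ys x) * (\sum_x cube F G ys x)^*.
Proof.
rewrite /cube_sum (big_tuple_cons _ (fun ys => \sum_x cube F G ys x)).
by rewrite exchange_big; apply: eq_bigr => ys _; rewrite sum_cube_cons.
Qed.

Lemma sum_cube_sum_mdiff F G m :
  \sum_y cube_sum (mdiff F y) (mdiff G y) m =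
  \sum_(ys : m.-tuple V) `|\sum_x cube F G ys x| ^+ 2.
Proof.
by rewrite exchange_big; apply: eq_bigr => ys _; rewrite sum_cube_mdiff.
Qed.

Lemma cube_sum_diagS F m :
  cube_sum F F m.+1 = \sum_(ys : m.-tuple V) `|\sum_x cube F F ys x| ^+ 2.
Proof. by rewrite cube_sumS; apply: eq_bigr => ys _; rewrite normCK. Qed.

Lemma cube_sum_diag_mdiff F m :
  \sum_y cube_sum (mdiff F y) (mdiff F y) m = cube_sum F F m.+1.
Proof. by rewrite sum_cube_sum_mdiff cube_sum_diagS. Qed.

(* The expansion of sum |a - d b|^2 >= 0, a form of Cauchy-Schwarz without
   square roots or a separate treatment of b = 0. *)
Lemma scaled_Cauchy_Schwarz (J : finType) (a b : J -> C) (d : C) : 0 <= d ->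
  d * (\sum_j `|b j| ^+ 2) <= \sum_j b j * (a j)^* ->
  d ^+ 2 * (\sum_j `|b j| ^+ 2) <= \sum_j `|a j| ^+ 2.
Proof.
set P := \sum_j `|b j| ^+ 2; set X := \sum_j _ * _ => d0 leX.
have P0 : 0 <= P by apply: sumr_ge0 => j _; rewrite exprn_ge0.
have X0 : 0 <= X by apply: le_trans leX; rewrite mulr_ge0.
have XE : \sum_j a j * (b j)^* = X.
  rewrite -[RHS](CrealP (ger0_real X0)) rmorph_sum.
  by apply: eq_bigr => j _; rewrite rmorphM /= conjCK mulrC.
have dE : d^* = d by apply/CrealP/ger0_real.
have : 0 <= \sum_j `|a j - d * b j| ^+ 2.
  by apply: sumr_ge0 => j _; rewrite exprn_ge0.
rewrite (eq_bigr (fun j => `|a j| ^+ 2 - d * (a j * (b j)^*)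
    - d * (b j * (a j)^*) + d ^+ 2 * `|b j| ^+ 2)); last first.
  by move=> j _; rewrite !normCK rmorphB rmorphM /= dE; ring.
rewrite big_split !sumrB /= -!mulr_sumr XE -/X -/P => H.
(* The expansion bounds the difference of the two sides below by [2 d (X - d P)], which is
   nonnegative by [leX]. *)
rewrite -subr_ge0; apply: le_trans (_ : d * (X - d * P) *+ 2 <= _).
  by rewrite mulrn_wge0 // mulr_ge0 // subr_ge0.
rewrite -subr_ge0; apply: le_trans H _.
by apply/eq_ler; ring.
Qed.

(** Each Cauchy-Schwarz step removes one direction, squares [d] and replaces the functions by their
    multiplicative derivatives along all [y]. The index type absorbs [y], so that the induction
    closes. *)
Lemma cube_sum_family_lower m (I : finType) (F G : I -> V -> C) (d : C) :
  0 <= d ->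
  d * (\sum_i cube_sum (G i) (G i) m) <= \sum_i cube_sum (F i) (G i) m ->
  d ^+ (2 ^ m) * (\sum_i cube_sum (G i) (G i) m) <=
    \sum_i cube_sum (F i) (F i) m.
Proof.
elim: m I F G d => [|m IH] I F G d d0 led.
  rewrite expn0 expr1; apply: le_trans led _; apply/eq_ler/eq_bigr => i _.
  by apply: eq_bigr => ys _; rewrite tuple0.
rewrite expnS exprM.
have pairE (H K : I -> V -> C) :
    \sum_(z : I * V) cube_sum (mdiff (H z.1) z.2) (mdiff (K z.1) z.2) m =
    \sum_(j : I * m.-tuple V) `|\sum_x cube (H j.1) (K j.1) j.2 x| ^+ 2.
  rewrite -(pair_bigA _ (fun i y => cube_sum (mdiff (H i) y) (mdiff (K i) y) m)).
  rewrite -(pair_bigA _ (fun i (ys : m.-tuple V) =>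
    `|\sum_x cube (H i) (K i) ys x| ^+ 2)).
  by apply: eq_bigr => i _; rewrite sum_cube_sum_mdiff.
have diagE (H : I -> V -> C) : \sum_i cube_sum (H i) (H i) m.+1 =
    \sum_(z : I * V) cube_sum (mdiff (H z.1) z.2) (mdiff (H z.1) z.2) m.
  rewrite -(pair_bigA _ (fun i y => cube_sum (mdiff (H i) y) (mdiff (H i) y) m)).
  by apply: eq_bigr => i _; rewrite cube_sum_diag_mdiff.
rewrite !diagE; apply: IH; first exact: exprn_ge0.
rewrite !pairE; apply: scaled_Cauchy_Schwarz => //.
rewrite -pairE -diagE; apply: le_trans led _; apply/eq_ler.
rewrite -(pair_bigA _ (fun i (ys : m.-tuple V) =>
  (\sum_x cube (G i) (G i) ys x) * (\sum_x cube (F i) (G i) ys x)^*)).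
by apply: eq_bigr => i _; rewrite cube_sumS.
Qed.

Lemma cube_sum_lower m F G (d : C) : 0 <= d ->
  d * cube_sum G G m <= cube_sum F G m ->
  d ^+ (2 ^ m) * cube_sum G G m <= cube_sum F F m.
Proof.
move=> d0 led.
have := @cube_sum_family_lower m unit (fun=> F) (fun=> G) d d0.
by rewrite !big_const !card_unit /= !addr0; apply.
Qed.

Section LevelSets.

Variables (U : zmodType) (g : V -> U) (A : V -> C).
Hypothesis A_supp : forall x, A x != 0 -> g x = 0.

Lemma fdiffs_cube_neq0 ys x : cube A A ys x != 0 -> fdiffs g ys x = 0.
Proof.
elim: ys x => [|y ys IH] x /=; first exact: A_supp.
by rewrite mulf_eq0 conjC_eq0 negb_or => /andP[/IH-> /IH->]; rewrite subrr.
Qed.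

(* If g vanishes at all vertices of a cube but one, and its iterated difference
   over the cube vanishes, then g vanishes at the remaining vertex too. *)
Lemma cube_last_vertex F F' ys x : (forall z, g z = 0 -> F z = F' z) ->
  fdiffs g ys x = 0 -> cube F A ys x = cube F' A ys x.
Proof.
move=> FF'; elim: ys x => [|y ys IH] x /=; first exact: FF'.
have [->|/fdiffs_cube_neq0 ->] := eqVneq (cube A A ys (x + y)) 0.
  by rewrite !mul0r.
by rewrite sub0r => /eqP; rewrite oppr_eq0 => /eqP /IH ->.
Qed.

End LevelSets.

Lemma cube_char (U : zmodType) (E : U -> C) (f : V -> U) ys x :
  (forall a b, E (a - b) = E a * (E b)^*) ->
  cube (fun z => E (f z)) (fun z => E (f z)) ys x = E (fdiffs f ys x).
Proof. by move=> EB; elim: ys x => //= y ys IH x; rewrite !IH EB. Qed.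

Lemma cube_one ys x : cube (fun=> 1) (fun=> 1) ys x = 1.
Proof. by elim: ys x => //= y ys IH x; rewrite !IH rmorph1 mulr1. Qed.

Lemma cube_sum_real_one m F : (forall x, (F x)^* = F x) ->
  cube_sum F (fun=> 1) m = (#|V| ^ m)%:R * \sum_x F x.
Proof.
move=> Freal.
have E ys x : cube F (fun=> 1) ys x = F x.
  by elim: ys x => //= y ys IH x; rewrite cube_one IH mul1r.
rewrite /cube_sum.
under eq_bigr => ys _ do under eq_bigr do rewrite E.
by rewrite sumr_const card_tuple mulr_natl.
Qed.

Lemma cube_sum_one m : cube_sum (fun=> 1) (fun=> 1) m = (#|V| ^ m.+1)%:R.
Proof.
rewrite cube_sum_real_one => [|x]; last exact: rmorph1.
by rewrite sumr_const -natrM mulnC -expnS.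
Qed.

Lemma cube_sum_level_lower (U : zmodType) (g : V -> U) (c : U) F m :
  (forall ys x, size ys = m.+1 -> fdiffs g ys x = 0) ->
  (forall x, g x = c -> F x = 1) ->
  (#|[set x | g x == c]|%:R / #|V|%:R) ^+ (2 ^ m.+1) * (#|V| ^ m.+2)%:R <=
    cube_sum F F m.+1.
Proof.
move=> g0 F1; pose A x : C := (g x == c)%:R.
have V0 : #|V|%:R != 0 :> C by rewrite pnatr_eq0 -lt0n; apply/card_gt0P; exists 0.
have Areal x : (A x)^* = A x by rewrite /A conjC_nat.
have sumA : \sum_x A x = #|[set x | g x == c]|%:R.
  rewrite /A -natr_sum -sum1dep_card [in RHS]big_mkcond.
  by congr _%:R; apply: eq_bigr => x _; case: eqP.
(* First comparison, of [A] with the constant 1: the ratio [d] is the density of the level set. *)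
apply: (@le_trans _ _ (cube_sum A A m.+1)).
  rewrite -cube_sum_one; apply: cube_sum_lower.
    by rewrite divr_ge0.
  rewrite cube_sum_one cube_sum_real_one // sumA expnS natrM mulrA divfK //.
  by rewrite mulrC.
(* Second comparison, of [F] with [A], with ratio 1: a cube with all vertices but one in the level
   set lies in it, and [F] is 1 there. *)
rewrite -[leLHS]mul1r -(expr1n C (2 ^ m.+1)); apply: cube_sum_lower => //.
rewrite mul1r; apply/eq_ler; apply: eq_bigr => ys _; apply: eq_bigr => x _.
apply: (@cube_last_vertex _ (fun z => g z - c)).
- by move=> z; rewrite /A; have [->|] := eqVneq (g z) c; rewrite ?subrr ?eqxx.
- by move=> z /eqP; rewrite subr_eq0 => /eqP gz; rewrite F1 // /A gz eqxx.
case: ys => [[|y ys] // sz].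
by apply: etrans (fdiffs_const_shift g c y ys x) (g0 _ _ _); apply/eqP.
Qed.

End Cubes.

(** * Units as an additive group *)

Section UnitGroup.

Variable A : comUnitRingType.

(* The unit group of A, written additively. *)
Record unitz := UnitZ { uz : A; _ : uz \is a GRing.unit }.

HB.instance Definition _ := [isSub for uz].
HB.instance Definition _ := [Choice of unitz by <:].

Lemma uz_unit (u : unitz) : uz u \is a GRing.unit.
Proof. by case: u. Qed.

Lemma unitz_mul_proof (u v : unitz) : uz u * uz v \is a GRing.unit.
Proof. by rewrite unitrM !uz_unit. Qed.

Lemma unitz_inv_proof (u : unitz) : (uz u)^-1 \is a GRing.unit.
Proof. by rewrite unitrV uz_unit. Qed.

Let add u v := UnitZ (unitz_mul_proof u v).
Let opp u := UnitZ (unitz_inv_proof u).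
Let zero := UnitZ (unitr1 A).

Let addA : associative add.
Proof. by move=> u v w; apply: val_inj; exact: mulrA. Qed.
Let addC : commutative add.
Proof. by move=> u v; apply: val_inj; exact: mulrC. Qed.
Let add0 : left_id zero add.
Proof. by move=> u; apply: val_inj; exact: mul1r. Qed.
Let addN : left_inverse zero opp add.
Proof. by move=> u; apply: val_inj; apply: mulVr; exact: uz_unit. Qed.

HB.instance Definition _ := GRing.isZmodule.Build unitz addA addC add0 addN.

Lemma uzD (u v : unitz) : uz (u + v) = uz u * uz v. Proof. by []. Qed.

Lemma uzMn (u : unitz) n : uz (u *+ n) = uz u ^+ n.
Proof. by elim: n => // n IH; rewrite mulrS exprS uzD IH. Qed.

Lemma uz_sum (I : finType) (u : I -> unitz) :
  uz (\sum_i u i) = \prod_i uz (u i).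
Proof. by apply: (big_morph uz uzD). Qed.

(** The inverse is the finite geometric series in [- x]. *)
Lemma unitr_1Dnilpotent (x : A) n : x ^+ n = 0 -> 1 + x \is a GRing.unit.
Proof.
move=> xn0; apply/unitrPr; exists (\sum_(i < n) (- x) ^+ i).
apply: oppr_inj; rewrite -mulNr opprD addrC -subrX1 exprNn xn0 mulr0 sub0r //.
Qed.

End UnitGroup.

(** * The map [a |-> 1 + a t] for nilpotent [t] *)

Section TruncatedLinear.

Variables (p : nat) (p_pr : prime p) (A : comUnitAlgType 'F_p) (t : A).
Hypothesis t_nilp : t ^+ (2 * p).+1 = 0.

Lemma unit_1Dscale (a : 'F_p) : 1 + a *: t \is a GRing.unit.
Proof.
by apply: (@unitr_1Dnilpotent _ _ (2 * p).+1); rewrite exprZn t_nilp scaler0.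
Qed.

Definition lin1 (a : 'F_p) : unitz A := UnitZ (unit_1Dscale a).

(** Frobenius is additive in characteristic [p] and fixes [F_p]. *)
Lemma uz_lin1_p a : uz (lin1 a *+ p) = 1 + a *: t ^+ p.
Proof.
have charA : p \in [pchar A] by rewrite pchar_lalg pchar_Fp.
rewrite uzMn /= exprDn_pchar ?pnatE // expr1n exprZn.
by rewrite -[X in a ^+ X](card_Fp p_pr) expf_card.
Qed.

(* With s = t^p and s^3 = 0, the ratio of the two sides of
   (1+(a+3)s)(1+(a+1)s)^3 = (1+(a+2)s)^3(1+as) is the third difference. *)
Lemma lin1_p_third_difference a :
  fdiffs (fun z => lin1 z *+ p) (nseq 3 1) a = 0.
Proof.
have s3 : (t ^+ p) ^+ 3 = 0.
  rewrite -exprM -(subnKC (_ : (2 * p).+1 <= p * 3)%N) ?exprD ?t_nilp ?mul0r //.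
  by rewrite (mulnC p) ltn_pmul2r ?prime_gt0.
pose f z := lin1 z *+ p.
rewrite (fdiffs_nseq_binomial f 1) !big_ord_recl big_ord0 /= /bump /= addr0.
rewrite expr0 mul1r mulr1z.
change (f (a + 3) + (f (a + 2) *~ (- 3%:Z) + (f (a + 1) *~ 3%:Z +
  f (a + 0) *~ (- 1%:Z))) = 0).
rewrite !mulrNz mulr1z -!pmulrn addr0.
suff E : f (a + 3) + f (a + 1) *+ 3 = f (a + 2) *+ 3 + f a.
  by rewrite addrCA [X in _ + X]addrA E addrK addNr.
have fE z : uz (f z) = 1 + z *: t ^+ p := uz_lin1_p z.
clearbody f; apply: val_inj; rewrite [LHS]uzD [RHS]uzD !uzMn !fE.
rewrite !scalerDl !scale1r; set s := t ^+ p in s3 *; set b := a *: s.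
apply/eqP; rewrite -subr_eq0; apply/eqP.
transitivity (s ^+ 3 * (2 + 2 * b + 3 * s)); last by rewrite s3 mul0r.
ring.
Qed.

Lemma lin1_fdiffs ys a : size ys = p.+2 -> fdiffs lin1 ys a = 0.
Proof.
move=> sz; apply: fdiffs_all_steps sz a => x.
have -> : p.+2 = (3 + p.-1)%N by rewrite -[in LHS](prednK (prime_gt0 p_pr)).
exact: fdiffs_prime_torsion lin1_p_third_difference _.
Qed.

Definition genfun N (x : Fvec p N) : unitz A := \sum_i lin1 (x ord0 i).

Lemma uz_genfun N (x : Fvec p N) : uz (genfun x) = \prod_i (1 + x ord0 i *: t).
Proof. exact: uz_sum. Qed.

(** [genfun] is a sum of [lin1] composed with the additive coordinate maps. *)
Lemma genfun_fdiffs N (ys : seq (Fvec p N)) x :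
  size ys = p.+2 -> fdiffs (@genfun N) ys x = 0.
Proof.
move=> sz; apply: etrans (fdiffs_sum _ _ _ _) _; apply: big1 => i _.
pose ev (z : Fvec p N) := z ord0 i.
have evA : zmod_morphism ev by move=> u v; rewrite /ev !mxE.
pose evL := HB.pack_for {additive Fvec p N -> 'F_p} ev
  (GRing.isZmodMorphism.Build _ _ ev evA).
apply: etrans (fdiffs_comp evL lin1 ys x) _.
by apply: lin1_fdiffs; rewrite size_map.
Qed.

End TruncatedLinear.

(** Pigeonhole, with [x] chosen in a fiber of maximal size. *)
Lemma large_fiber (V T : finType) (g : V -> T) (v : V) :
  exists x, (#|V| <= #|T| * #|[set z | g z == g x]|)%N.
Proof.
pose c x := #|[set z | g z == g x]|.
have [x _ xmax] := arg_maxnP c (isT : xpredT v).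
exists x; rewrite -[leqLHS]sum1_card (partition_big g xpredT) //=.
rewrite -sum_nat_const; apply: leq_sum => q _; rewrite sum1_card.
have [->//|] := eqVneq #|[pred z | g z == q]| 0%N.
rewrite -lt0n => /card_gt0P[z]; rewrite inE => /eqP <-.
by apply: leq_trans (xmax z isT); rewrite /c cardsE.
Qed.

(** * Symmetric polynomials as coefficients *)

Section EsymCoefficient.

Variable p : nat.

Lemma coef_prod_1DZX N (x : Fvec p N) m :
  (\prod_i (1 + x ord0 i *: 'X))`_m = esym_fun m x.
Proof.
under eq_bigr do rewrite addrC.
rewrite bigA_distr coef_sum /esym_fun [RHS]big_mkcond; apply: eq_bigr => J _.
rewrite -big_mkcond /= scaler_prod prodr_const coefZ coefXn eq_sym.
by case: eqP; rewrite ?mulr1 ?mulr0.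
Qed.

Lemma qpolyX_nilpotent m : (0 < m)%N -> ('qX : {poly %/ 'X^m : {poly 'F_p}}) ^+ m = 0.
Proof.
move=> m0; rewrite -rmorphXn /=; apply: val_inj => /=.
by rewrite mk_monic_Xn prednK // Pdiv.RingMonic.rmodpp ?monicXn.
Qed.

(** Reduction modulo ['X^n] leaves the coefficients below degree [n] unchanged. *)
Lemma coef_prod_1DZqX N (x : Fvec p N) n m : (m < n)%N ->
  (val (\prod_i (1 + x ord0 i *: 'qX : {poly %/ 'X^n : {poly 'F_p}})))`_m =
  esym_fun m x.
Proof.
move=> mn.
have -> : \prod_i (1 + x ord0 i *: 'qX : {poly %/ 'X^n : {poly 'F_p}}) =
    in_qpoly 'X^n (\prod_i (1 + x ord0 i *: 'X)).
  rewrite rmorph_prod; apply: eq_bigr => i _.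
  by rewrite rmorphD rmorph1 /= in_qpolyZ.
rewrite /= mk_monic_Xn prednK ?(leq_ltn_trans _ mn) // -Pdiv.RingMonic.take_poly_rmodp.
by rewrite coef_take_poly mn coef_prod_1DZX.
Qed.

End EsymCoefficient.

(** * The character [ep] *)

Section AdditiveCharacter.

Variables (R : realType) (p : nat) (p_pr : prime p).

Lemma ep_nat n : ep R (n%:R : 'F_p) =
  (cos (2 * pi * n%:R / p%:R) +i* sin (2 * pi * n%:R / p%:R))%C.
Proof.
have p0 : p%:R != 0 :> R by rewrite pnatr_eq0 -lt0n prime_gt0.
rewrite /ep val_Fp_nat //.
have -> : 2 * pi * n%:R / p%:R =
    2 * pi * (n %% p)%:R / p%:R + (pi *+ 2) *+ (n %/ p) :> R.
  rewrite {1}(divn_eq n p) natrD natrM -[pi *+ 2 *+ _]mulr_natr -[pi *+ 2]mulr_natr.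
  by field.
by rewrite (periodicn (@cosD2pi R)) (periodicn (@sinD2pi R)).
Qed.

Lemma epD (a b : 'F_p) : ep R (a + b) = ep R a * ep R b.
Proof.
rewrite -[a]natr_Zp -[b]natr_Zp -natrD !ep_nat natrD mulrDr mulrDl cosD sinD.
by apply/eqP; rewrite eq_complex /= eqxx addrC eqxx.
Qed.

Lemma epB (a b : 'F_p) : ep R (a - b) = ep R a * (ep R b)^*.
Proof.
have bb : ep R b * (ep R b)^* = 1.
  apply/eqP; rewrite eq_complex /=; apply/andP; split; apply/eqP.
    by rewrite mulrN opprK -!expr2 cos2Dsin2.
  by rewrite mulrN mulrC addNr.
by rewrite -{2}(subrK b a) (epD (a - b)) -mulrA bb mulr1.
Qed.

End AdditiveCharacter.

(** * From level sets to Gowers norms *)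

Section GowersLowerBound.

Variables (R : realType) (p : nat) (p_pr : prime p) (N : nat).
Variables (U : zmodType) (g : Fvec p N -> U) (f : Fvec p N -> 'F_p) (k : nat).
Hypothesis g_deg : forall ys x, size ys = k.+1 -> fdiffs g ys x = 0.

(** With at least one direction, subtracting [c] leaves the derivatives unchanged; the choice of [c]
    makes the phase 1 on a level set. *)
Lemma gowers_avgE (c : 'F_p) :
  let F x := ep R (f x - c) in
  gowers_avg R k.+1 f = cube_sum F F k.+1 / (#|{: Fvec p N}| ^ k.+2)%:R.
Proof.
congr (_ / _); rewrite exchange_big; apply: eq_bigr => ys _; apply: eq_bigr => x _.
rewrite iderivsE (cube_char (E := @ep R p) (fun z => f z - c) _ _ (@epB R p p_pr)).
by case: ys => -[|y ys] // sz; congr ep; rewrite fdiffs_const_shift.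
Qed.

Lemma gowers_norm_level_lower (x0 : Fvec p N) (q : R) :
  (forall x, g x = g x0 -> f x = f x0) -> 0 <= q ->
  q * #|{: Fvec p N}|%:R <= #|[set x | g x == g x0]|%:R ->
  q <= gowers_norm R k.+1 f.
Proof.
move=> fg q0 leq; set V : predArgType := Fvec p N in leq *.
have V0 : 0 < #|V|%:R :> R by rewrite ltr0n; apply/card_gt0P; exists 0.
pose r : R := #|[set x | g x == g x0]|%:R / #|V|%:R.
have ler : q <= r by rewrite ler_pdivlMr.
have ReE : r ^+ (2 ^ k.+1) <= complex.Re (gowers_avg R k.+1 f).
  have ep0 : ep R (0 : 'F_p) = 1.
    by rewrite -[0]/(0%:R) ep_nat // mulr0 mul0r cos0 sin0.
  have := @cube_sum_level_lower _ R[i]%C _ g (g x0)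
    (fun x => ep R (f x - f x0)) k g_deg.
  have -> : #|[set x | g x == g x0]|%:R / #|Fvec p N|%:R = (r%:C)%C :> R[i]%C.
    by rewrite rmorphM fmorphV !rmorph_nat.
  rewrite -ler_pdivlMr; last by rewrite ltr0n expn_gt0 -(ltr0n R) V0.
  rewrite -gowers_avgE -rmorphXn /= lecE /=.
  by case/(_ _)/andP => [x gx|//]; rewrite fg // subrr.
rewrite /gowers_norm.
apply: le_trans (_ : (q ^+ (2 ^ k.+1)) `^ ((2 ^ k.+1)%:R)^-1 <= _).
  by rewrite -powR_mulrn // -powRrM mulfV ?powRr1 // pnatr_eq0 expn_eq0.
apply: ge0_ler_powR; rewrite ?invr_ge0 ?ler0n ?nnegrE ?exprn_ge0 //.
  by apply: le_trans ReE; rewrite exprn_ge0 // (le_trans q0).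
by apply: le_trans ReE; rewrite lerXn2r ?nnegrE // (le_trans q0).
Qed.

End GowersLowerBound.

Theorem theorem1p2 (R : realType) (p : nat) (hp : prime p) :
  exists eps : R, 0 < eps /\
    forall N : nat, (1 <= N)%N ->
      eps < gowers_norm R p.+2 (@esym_fun p N (2 * p)).
Proof.
pose Q := {poly %/ 'X^((2 * p).+1) : {poly 'F_p}}.
have Q0 : 0 < #|Q|%:R :> R by rewrite ltr0n; apply/card_gt0P; exists 0.
(* [Q] has [p^(2p+1)] elements, so this depends on [p] alone; halving makes the inequality
   strict. *)
exists ((#|Q|%:R)^-1 / 2); split=> [|N _]; first by rewrite divr_gt0 ?invr_gt0.
have tn := qpolyX_nilpotent p (ltn0Sn (2 * p)).
pose g := @genfun p Q 'qX tn N.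
(* Pigeonhole uses the finite codomain [Q], hence the values [uz (g x)]; injectivity of [uz] then
   recovers the fibers of [g]. *)
have [x0 leV] := large_fiber (fun x => uz (g x)) (0 : Fvec p N).
apply: (@lt_le_trans _ _ (#|Q|%:R)^-1).
  by rewrite ltr_pdivrMr // ltr_pMr ?invr_gt0 // ltr1n.
apply: (@gowers_norm_level_lower R p hp N _ g _ _ _ x0).
- by move=> ys x; exact: genfun_fdiffs.
- move=> x gx; rewrite -!(coef_prod_1DZqX _ (leqnn (2 * p).+1)).
  by rewrite -!(uz_genfun tn) -/g gx.
- by rewrite invr_ge0 ltW.
rewrite mulrC ler_pdivrMr // -natrM ler_nat mulnC.
apply: leq_trans leV _; rewrite leq_mul2l; apply/orP; right.
apply/subset_leq_card/fintype.subsetP => z.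
by rewrite !inE => /eqP /val_inj ->.
Qed.
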